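(* Let $m,n\ge 1$, let $f,g:\mathbb{R}^n\times\mathbb{R}^m\to\mathbb{R}$ with $f$ of class $C^2$ and $g$ of class $C^3$. Write $g_x:=g(x,\cdot)$. Assume that there is $L_g>0$ such that for all $x\in\mathbb{R}^n$, $g_x$ is coercive and has an $L_g$-Lipschitz continuous gradient, and let $\alpha_g$ satisfy $0<\alpha_gL_g<1$. Then for any $k\in\mathbb{N}$, up to a diffeomorphism, the critical points of $f$ are the same as those of $\varphi^k$, with the same objective value and the same index. That is, there is a diffeomorphism $\Phi$ of $\mathbb{R}^n\times\mathbb{R}^m$ onto itself such that a point $p$ is a critical point of $\varphi^k$ if and only if $\Phi(p)$ is a critical point of $f$, and for every critical point $p$ of $\varphi^k$: $\varphi^k(p)=f(\Phi(p))$; $p$ is a local minimum (resp. local maximum) of $\varphi^k$ if and only if $\Phi(p)$ is a local minimum (resp. local maximum) of $f$; and $\nabla^2\varphi^k(p)$ and $\nabla^2f(\Phi(p))$ have the same numbers of positive, negative and zero eigenvalues.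
   Context: Lower-level gradient descent: $\mathcal{A}(x,z):=z-\alpha_g\nabla_yg(x,z)$, and $\mathcal{A}^k(x,z)$ is the result of $k$ iterations $y_j=\mathcal{A}(x,y_{j-1})$ started at $y_0=z$. Set $\varphi^k(x,z):=f(x,\mathcal{A}^k(x,z))$. *)

(* Defs.v *)
From HB Require Import structures.
From mathcomp Require Import all_boot all_order all_algebra.
From mathcomp Require Import all_classical all_reals all_analysis.

Set Implicit Arguments.
Unset Strict Implicit.
Unset Printing Implicit Defensive.

Import Order.TTheory GRing.Theory Num.Theory.
Import numFieldNormedType.Exports.

Local Open Scope classical_set_scope.
Local Open Scope ring_scope.

(* In finite dimension the derivative, as a map into the space of linear maps,
   is of class C^k if and only if its evaluation at every fixed vector is. *)
Fixpoint class_C (R : realType) (V W : normedModType R) (k : nat)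
    (h : V -> W) : Prop :=
  if k is k'.+1 then
    (forall p, differentiable h p) /\
    (forall v, class_C k' (fun p => 'd h p v))
  else continuous h.

(* The library's norm on row vectors is the sup norm; the Lipschitz constant in
   0 < alpha * L < 1 refers to the Euclidean one. *)
Definition l2norm (R : realType) (m : nat) (u : 'rV[R]_m) : R :=
  Num.sqrt (\sum_(j < m) u 0 j ^+ 2).

Definition gradient (R : realType) (m : nat) (h : 'rV[R]_m -> R)
    (y : 'rV[R]_m) : 'rV[R]_m :=
  \row_(j < m) 'D_(delta_mx 0 j) h y.

Definition l2lipschitz (R : realType) (m : nat) (L : R)
    (F : 'rV[R]_m -> 'rV[R]_m) : Prop :=
  forall y z, l2norm (F y - F z) <= L * l2norm (y - z).

Definition coercive (R : realType) (m : nat) (h : 'rV[R]_m -> R) : Prop :=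
  forall M : R, exists r : R, forall y, r <= l2norm y -> M <= h y.

Definition gd_step (R : realType) (n m : nat) (g : 'rV[R]_n * 'rV[R]_m -> R)
    (alpha : R) (x : 'rV[R]_n) (z : 'rV[R]_m) : 'rV[R]_m :=
  z - alpha *: gradient (fun y => g (x, y)) z.

Definition phi (R : realType) (n m : nat) (f g : 'rV[R]_n * 'rV[R]_m -> R)
    (alpha : R) (k : nat) (p : 'rV[R]_n * 'rV[R]_m) : R :=
  f (p.1, iter k (gd_step g alpha p.1) p.2).

(* Diffeomorphism onto, in the regularity class C^2 of f and phi. *)
Definition diffeomorphism (R : realType) (V : normedModType R)
    (Phi : V -> V) : Prop :=
  exists Psi : V -> V,
    [/\ cancel Phi Psi, cancel Psi Phi, class_C 2 Phi & class_C 2 Psi].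

Definition critical_point (R : realType) (V : normedModType R) (h : V -> R)
    (p : V) : Prop :=
  forall v, 'd h p v = 0.

Definition local_minimum (R : realType) (V : normedModType R) (h : V -> R)
    (p : V) : Prop :=
  \forall q \near p, h p <= h q.

Definition local_maximum (R : realType) (V : normedModType R) (h : V -> R)
    (p : V) : Prop :=
  \forall q \near p, h q <= h p.

(* Standard basis of R^n x R^m, indexed by 'I_(n + m). *)
Definition prod_basis (R : realType) (n m : nat) (i : 'I_(n + m)) :
    'rV[R]_n * 'rV[R]_m :=
  let e : 'rV[R]_(n + m) := delta_mx 0 i in (lsubmx e, rsubmx e).

Definition hessian (R : realType) (n m : nat) (h : 'rV[R]_n * 'rV[R]_m -> R)
    (p : 'rV[R]_n * 'rV[R]_m) : 'M[R]_(n + m) :=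
  \matrix_(i, j) 'D_(prod_basis R i) (fun q => 'D_(prod_basis R j) h q) p.

(* Number of real eigenvalues of A in P, with multiplicity; the support of
   mup is the finite set of roots of char_poly A. *)
Definition eigenvalue_count (R : realType) (N : nat) (P : set R)
    (A : 'M[R]_N) : nat :=
  \big[addn/0%N]_(x \in P) mup x (char_poly A).

Definition same_inertia (R : realType) (N : nat) (A B : 'M[R]_N) : Prop :=
  [/\ eigenvalue_count [set x | 0 < x] A = eigenvalue_count [set x | 0 < x] B,
      eigenvalue_count [set x | x < 0] A = eigenvalue_count [set x | x < 0] B
    & eigenvalue_count [set 0] A = eigenvalue_count [set 0] B].

(* Main.v *)
(** Phi is the k-th iterate of T (x, z) := (x, z - alpha grad_y g (x, z)), so
    that phi = f \o Phi. As alpha grad_y g (x, .) is an l2 contraction, T is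
    bijective (a preimage is a fixed point) and |z - z'| <= M |T(x,z) - T(x,z')|
    for some M: its differential is injective and its inverse is continuous,
    hence of class C^2 by Cramer's rule. At a critical point, the
    Hessian of f \o Phi is congruent to that of f, and Sylvester's law of
    inertia, obtained from the spectral theorem over R[i], applies. *)

Require Import Defs.
From HB Require Import structures.
From mathcomp Require Import all_boot all_order all_algebra.
From mathcomp Require Import all_classical all_reals all_analysis.
From mathcomp Require Import ring lra complex.

Set Implicit Arguments.
Unset Strict Implicit.
Unset Printing Implicit Defensive.

Import Order.TTheory GRing.Theory Num.Theory.
Import numFieldNormedType.Exports.

Local Open Scope classical_set_scope.
Local Open Scope ring_scope.

(** The smooth inverse of [T] comes from one estimate along the fibres, which is global: a
    continuous inverse on the whole space is found first and differentiated afterwards, so no local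
    inverses have to be glued. The obstacle is that [alpha * L < 1] is a Euclidean condition while
    limits and differentials live in the sup norm. Changing norms costs a factor [Num.sqrt m%:R]:
    harmless in a bound with an arbitrary constant [M], but able to destroy a contraction constant
    below 1. Taking the gradient loses one derivative, so [g] of class C^3 makes [T] of class C^2,
    the order at which Hessians can be compared. The congruence is special to critical points:
    elsewhere the second derivative of [Phi] enters, multiplied by the first derivative of [f]. *)

Lemma scale_is_bilinear (R : realType) (W : normedModType R) :
  bilinear_for
    (GRing.Scale.Law.clone _ _ *:%R _) (GRing.Scale.Law.clone _ _ *:%R _)
    (@GRing.scale R W).
Proof.
split=> [u'|u] a x y /=.
- by rewrite scalerDl scalerA.
- by rewrite scalerDr !scalerA mulrC.
Qed.

(** Once scaling is a bilinear map, the product rule for a scalar times a vector is the differential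
    of a continuous bilinear map. *)
HB.instance Definition _ (R : realType) (W : normedModType R) :=
  bilinear_isBilinear.Build R R W W _ _ (@GRing.scale R W)
    (@scale_is_bilinear R W).

Section DiffScale.
Variables (R : realType) (V W : normedModType R) (h : V -> R) (u : V -> W).

Let scaleE : (fun q => h q *: u q) =
  (fun q : R * W => q.1 *: q.2) \o (fun q => (h q, u q)).
Proof. by []. Qed.

Lemma differentiable_scale p : differentiable h p -> differentiable u p ->
  differentiable (fun q => h q *: u q) p.
Proof.
move=> dh du; rewrite scaleE; apply: differentiable_comp.
  exact: differentiable_pair.
exact/differentiable_bilin/scale_continuous.
Qed.

Lemma diff_scale p v : differentiable h p -> differentiable u p ->
  'd (fun q => h q *: u q) p v = h p *: 'd u p v + 'd h p v *: u p.
Proof.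
move=> dh du; rewrite scaleE diff_comp /=; last 2 first.
- exact: differentiable_pair.
- exact/differentiable_bilin/scale_continuous.
rewrite diff_pair//= (@diff_bilin _ _ _ _ (@GRing.scale R W))//.
exact: scale_continuous.
Qed.

End DiffScale.

(** * Closure properties of C^k maps *)

Section ClassC.
Variable R : realType.
Implicit Types V W U : normedModType R.

Lemma class_C_differentiable V W k (h : V -> W) p :
  class_C k.+1 h -> differentiable h p.
Proof. by move=> [dh _]; exact: dh. Qed.

Lemma class_C_diff V W k (h : V -> W) v :
  class_C k.+1 h -> class_C k (fun p => 'd h p v).
Proof. by move=> [_ hC]; exact: hC. Qed.

Lemma class_C_continuous V W k (h : V -> W) : class_C k h -> continuous h.
Proof.
by case: k => [//|k] [dh _] p; apply: differentiable_continuous.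
Qed.

Lemma class_CS V W k (h : V -> W) : class_C k.+1 h -> class_C k h.
Proof.
elim: k h => [|k IH] h hC; first exact: class_C_continuous hC.
by case: hC => dh hC; split=> // v; apply: IH.
Qed.

Lemma class_C_cst V W k (a : W) : class_C k (fun _ : V => a).
Proof.
elim: k a => [|k IH] a /=; first exact: cst_continuous.
split=> [p|v]; first exact: differentiable_cst.
have -> : (fun p : V => 'd (fun=> a) p v) = (fun=> 0) :> (V -> W).
  by apply/funext => p; rewrite (diff_cst a p).
exact: IH.
Qed.

Lemma class_C_linear V W k (L : {linear V -> W}) :
  continuous L -> class_C k L.
Proof.
case: k => [//|k] Lc; split=> [p|v]; first exact: linear_differentiable.
have -> : (fun p : V => 'd L p v) = (fun=> L v) :> (V -> W).
  by apply/funext => p; rewrite diff_lin.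
exact: class_C_cst.
Qed.

Lemma class_C_comp_linear V W U k (L : {linear W -> U}) (h : V -> W) :
  continuous L -> class_C k h -> class_C k (fun p => L (h p)).
Proof.
move=> Lc; elim: k h => [|k IH] h hC.
  by move=> p; apply: continuous_comp; [exact: (class_C_continuous hC)|exact: Lc].
have dL q : differentiable L q by exact: linear_differentiable.
case: hC => dh hC; split=> [p|v].
  exact: (differentiable_comp (dh p) (dL _)).
rewrite (_ : (fun p => _) = (fun p => L ('d h p v))).
  exact: IH (hC v).
by apply/funext => p; rewrite (diff_comp (dh p))//= diff_lin.
Qed.

Lemma class_C_pair V W U k (h : V -> W) (u : V -> U) :
  class_C k h -> class_C k u -> class_C k (fun p => (h p, u p)).
Proof.
elim: k h u => [|k IH] h u hC uC.
  by move=> p; apply: cvg_pair; [exact: (class_C_continuous hC)|exact: (class_C_continuous uC)].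
case: hC uC => [dh hC] [du uC]; split=> [p|v].
  exact: differentiable_pair.
rewrite (_ : (fun p => _) = (fun p => ('d h p v, 'd u p v))).
  exact: IH (hC v) (uC v).
by apply/funext => p; rewrite diff_pair.
Qed.

Lemma class_C_fst V W k : class_C k (fst : V * W -> V).
Proof. by apply: (@class_C_linear _ _ k fst) => p; exact: cvg_fst. Qed.

Lemma class_C_snd V W k : class_C k (snd : V * W -> W).
Proof. by apply: (@class_C_linear _ _ k snd) => p; exact: cvg_snd. Qed.

Lemma class_CD V W k (h u : V -> W) :
  class_C k h -> class_C k u -> class_C k (fun p => h p + u p).
Proof.
elim: k h u => [|k IH] h u hC uC.
  by move=> p; apply: cvgD; [exact: (class_C_continuous hC)|exact: (class_C_continuous uC)].
case: hC uC => [dh hC] [du uC]; split=> [p|v]; first exact: differentiableD.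
rewrite (_ : (fun p => _) = (fun p => 'd h p v + 'd u p v)).
  exact: IH (hC v) (uC v).
by apply/funext => p; rewrite (diffD (dh p) (du p)).
Qed.

Lemma class_CZ V W k (h : V -> R) (u : V -> W) :
  class_C k h -> class_C k u -> class_C k (fun p => h p *: u p).
Proof.
elim: k h u => [|k IH] h u hC uC.
  by move=> p; apply: cvgZ; [exact: (class_C_continuous hC)|exact: (class_C_continuous uC)].
(* Each term of the product rule leaves one factor undifferentiated, so [h] and [u] themselves are
   also needed at order [k]. *)
have h0 := class_CS hC; have u0 := class_CS uC.
case: hC uC => [dh hC] [du uC]; split=> [p|v]; first exact: differentiable_scale.
rewrite (_ : (fun p => _) = (fun p => h p *: 'd u p v + 'd h p v *: u p)).
  by apply: class_CD; [exact: IH h0 (uC v)|exact: IH (hC v) u0].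
by apply/funext => p; rewrite diff_scale.
Qed.

Lemma class_CM V k (h u : V -> R) :
  class_C k h -> class_C k u -> class_C k (fun p => h p * u p).
Proof. exact: class_CZ. Qed.

Lemma class_CZl V W k a (h : V -> W) :
  class_C k h -> class_C k (fun p => a *: h p).
Proof. by move=> hC; apply: class_CZ => //; apply: class_C_cst. Qed.

Lemma class_CN V W k (h : V -> W) : class_C k h -> class_C k (fun p => - h p).
Proof.
move=> hC; rewrite (_ : (fun p => _) = (fun p => -1 *: h p)).
  exact: class_CZl.
by apply/funext => p; rewrite scaleN1r.
Qed.

Lemma class_C_sum V W k (I : Type) (r : seq I) (P : pred I) (h : I -> V -> W) :
  (forall i, class_C k (h i)) ->
  class_C k (fun p => \sum_(i <- r | P i) h i p).
Proof.
move=> hC; elim: r => [|i r IH].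
  rewrite (_ : (fun p => _) = (fun=> 0)); first exact: class_C_cst.
  by apply/funext => p; rewrite big_nil.
rewrite (_ : (fun p => _) = if P i then
    fun p => h i p + \sum_(j <- r | P j) h j p
  else fun p => \sum_(j <- r | P j) h j p).
  by case: (P i) => //; apply: class_CD.
by apply/funext => p; rewrite big_cons; case: (P i).
Qed.

Lemma class_C_prod V k (I : Type) (r : seq I) (P : pred I) (h : I -> V -> R) :
  (forall i, class_C k (h i)) ->
  class_C k (fun p => \prod_(i <- r | P i) h i p).
Proof.
move=> hC; elim: r => [|i r IH].
  rewrite (_ : (fun p => _) = (fun=> 1)); first exact: class_C_cst.
  by apply/funext => p; rewrite big_nil.
rewrite (_ : (fun p => _) = if P i then
    fun p => h i p * \prod_(j <- r | P j) h j p
  else fun p => \prod_(j <- r | P j) h j p).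
  by case: (P i) => //; apply: class_CM.
by apply/funext => p; rewrite big_cons; case: (P i).
Qed.

Lemma class_CV V k (h : V -> R) :
  (forall p, h p != 0) -> class_C k h -> class_C k (fun p => (h p)^-1).
Proof.
move=> h0; elim: k => [|k IH] hC.
  by move=> p; apply: cvgV; [exact: h0|exact: (class_C_continuous hC)].
(* The derivative of the inverse contains the inverse itself, whose smoothness at order [k] is the
   induction hypothesis. *)
have IHk := IH (class_CS hC).
case: hC => [dh hC]; split=> [p|v]; first exact: differentiableV.
rewrite (_ : (fun p => _) = (fun p => - ((h p)^-1 * (h p)^-1) * 'd h p v)).
  by apply: class_CM (hC v); apply: class_CN; apply: class_CM.
by apply/funext => p; rewrite diffV//= expr2 invfM.
Qed.

End ClassC.

(** Finite dimension is carried as data because the space in question is a product of row-vector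
    spaces, not itself a row-vector type. *)
Structure coordinates (R : realType) (V : normedModType R) (N : nat) :=
  Coordinates {
    coordinate :> {linear V -> 'rV[R]_N};
    basis_vector : 'I_N -> V;
    coordinate_continuous : continuous coordinate;
    coordinate_basis : forall i, coordinate (basis_vector i) = delta_mx 0 i;
    coordinateK : forall v, \sum_i coordinate v 0 i *: basis_vector i = v }.

Section Coordinates.
Variables (R : realType) (V : normedModType R) (N : nat).
Variable c : coordinates V N.
Local Notation e := (basis_vector c).

Lemma coordinate_coef_continuous j : continuous (fun v => c v 0 j).
Proof.
move=> v; apply: (@continuous_comp _ _ _ c (fun u : 'rV[R]_N => u 0 j)).
  exact: coordinate_continuous.
exact: coord_continuous.
Qed.

Lemma class_C_coordinate (U : normedModType R) k (h : U -> V) j :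
  class_C k h -> class_C k (fun p => c (h p) 0 j).
Proof.
have linc : linear (fun v => c v 0 j : R^o).
  by move=> a u v; rewrite linearP !mxE.
pose cM := GRing.isLinear.Build _ _ _ _ _ linc.
pose cL : {linear V -> R} := HB.pack (fun v => c v 0 j) cM.
by apply: (@class_C_comp_linear _ _ _ _ _ cL); exact: coordinate_coef_continuous.
Qed.

Lemma linear_coordinates (W : normedModType R) (L : {linear V -> W}) v :
  L v = \sum_j c v 0 j *: L (e j).
Proof.
rewrite -[in LHS](coordinateK c v) linear_sum.
by apply: eq_bigr => j _; rewrite linearZ.
Qed.

(** In ['d f (h p) ('d h p v)] the direction moves with [p], whereas [class_C] controls fixed
    directions only. Expanding it along the basis leaves the fixed directions [e j] with
    coefficients of class C^k. *)
Lemma class_C_comp (U W : normedModType R) k (h : U -> V) (f : V -> W) :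
  class_C k h -> class_C k f -> class_C k (f \o h).
Proof.
elim: k h f => [|k IH] h f hC fC.
  move=> p; apply: continuous_comp; first exact: class_C_continuous hC _.
  exact: class_C_continuous fC _.
have h0 := class_CS hC.
case: hC fC => [dh hC] [df fC]; split=> [p|v]; first exact: differentiable_comp.
rewrite (_ : (fun p => _) =
  (fun p => \sum_j c ('d h p v) 0 j *: 'd f (h p) (e j))).
  apply: class_C_sum => j; apply: class_CZ; first exact: class_C_coordinate (hC v).
  exact: IH _ _ h0 (fC (e j)).
by apply/funext => p; rewrite diff_comp//= linear_coordinates.
Qed.

(** Images of basis vectors are rows: this is the transpose of the usual matrix, acting on row
    vectors from the right. *)
Definition coordinate_mx (D : V -> V) : 'M[R]_N := \matrix_(i, j) c (D (e i)) 0 j.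

Lemma coordinate_inj : injective c.
Proof. by move=> u v uv; rewrite -(coordinateK c u) uv coordinateK. Qed.

Lemma coordinate_mxE (D : {linear V -> V}) v : c (D v) = c v *m coordinate_mx D.
Proof.
rewrite (linear_coordinates D); apply/rowP => j.
rewrite linear_sum summxE mxE; apply: eq_bigr => i _.
by rewrite linearZ !mxE.
Qed.

Lemma coordinate_surj (u : 'rV_N) : c (\sum_j u 0 j *: e j) = u.
Proof.
rewrite linear_sum [RHS]row_sum_delta; apply: eq_bigr => j _.
by rewrite linearZ/= coordinate_basis.
Qed.

(** Each row of the left kernel is the coordinate vector of an element killed by [D], hence zero. *)
Lemma coordinate_mx_unit (D : {linear V -> V}) :
  (forall v, D v = 0 -> v = 0) -> coordinate_mx D \in unitmx.
Proof.
move=> D0; rewrite -row_free_unit -kermx_eq0; apply/eqP/row_matrixP => i.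
rewrite row0; set u := row i _.
have uD : u *m coordinate_mx D = 0 by apply/sub_kermxP; exact: row_sub.
have v0 : \sum_j u 0 j *: e j = 0.
  apply: D0; apply: coordinate_inj.
  by rewrite coordinate_mxE coordinate_surj uD linear0.
by rewrite -(coordinate_surj u) v0 linear0.
Qed.

End Coordinates.

(** * Smoothness of determinants and matrix inverses *)

Section MatrixClassC.
Variables (R : realType) (V : normedModType R) (k : nat).

Lemma class_C_det N (A : V -> 'M[R]_N) :
  (forall i j, class_C k (fun p => A p i j)) ->
  class_C k (fun p => \det (A p)).
Proof.
move=> AC; apply: class_C_sum => s; apply: class_CM; first exact: class_C_cst.
by apply: class_C_prod => i; exact: AC.
Qed.

Lemma class_C_invmx N (A : V -> 'M[R]_N) :
  (forall p, A p \in unitmx) -> (forall i j, class_C k (fun p => A p i j)) ->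
  forall i j, class_C k (fun p => invmx (A p) i j).
Proof.
move=> Au AC i j.
rewrite (_ : (fun p => _) = fun p => (\det (A p))^-1 * cofactor (A p) j i).
  apply: class_CM.
    apply: class_CV; last exact: class_C_det.
    by move=> p; have := Au p; rewrite unitmxE unitfE.
  apply: class_CM; first exact: class_C_cst.
  apply: class_C_det => a b.
  rewrite (_ : (fun p => _) = fun p => A p (lift j a) (lift i b)); first exact: AC.
  by apply/funext => p; rewrite !mxE.
by apply/funext => p; rewrite /invmx Au !mxE.
Qed.

End MatrixClassC.

(** * Differentiating a continuous inverse *)

Section InverseFunction.
Variables (R : realType) (V : normedModType R) (N : nat).
Variable c : coordinates V N.
Local Notation e := (basis_vector c).

(** With [d = S (h + q) - S q], the expansion of [T] at [S q] reads [h = 'd T (S q) d + o(d)], valid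
    for small [h] since [S] is continuous. Applying [Di] gives [d = Di h + o(d)]; absorbing the
    error yields [d = O(h)], so the error is [o(h)]. *)
Lemma diff_inverse (T S : V -> V) (Di : {linear V -> V}) q :
  cancel S T -> {for q, continuous S} ->
  differentiable T (S q) -> continuous Di -> cancel ('d T (S q)) Di ->
  differentiable S q /\ 'd S q = Di :> (V -> V).
Proof.
move=> SK Sc dT Dic DiK; set p := S q.
have S_diff : S \o shift q = cst (S q) + Di +o_ 0 id.
  apply/eqaddoP => _/posnumP[eps].
  have [M M0 DiM] := linear_lipschitz Dic.
  (* The first bound gives [M * e1 <= 1/2], so that half of [d] absorbs the error; the second turns
     the final error [M * e1 * (2 * M *]|h|)[into at most]eps * [|h|]. *)
  pose e1 := Order.min (2 * M)^-1 (eps%:num / (2 * M * M)).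
  have e10 : 0 < e1 by rewrite lt_min !(invr_gt0, divr_gt0, mulr_gt0).
  have /diff_locallyP[_ /eqaddoP/(_ e1 e10) Tnear] := dT.
  have Snear : (fun h => S (h + q) - p) @ (0 : V) --> (0 : V).
    rewrite -[X in _ --> X](subrr p); apply: cvgB; last exact: cvg_cst.
    have : S \o shift q @ (0 : V) --> S q.
      by rewrite cvg_comp_shift add0r; exact: Sc.
    exact.
  near=> h.
  have : `|T (S (h + q) - p + p) - (T p + 'd T p (S (h + q) - p))|
      <= e1 * `|S (h + q) - p|.
    near: h; exact: (Snear _ Tnear).
  rewrite subrK SK /p SK -/p; set d := S (h + q) - p.
  have -> : h + q - (q + 'd T p d) = h - 'd T p d by rewrite opprD addrA addrK.
  move=> Td.
  have DiTd : `|Di h - d| <= M * (e1 * `|d|).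
    rewrite -[d in Di h - d]DiK -linearB; apply: le_trans (DiM _) _.
    by rewrite ler_pM2l.
  have dh : `|d| <= 2 * M * `|h|.
    have Dih : `|d| <= M * `|h| + M * (e1 * `|d|).
      have -> : d = Di h - (Di h - d) by rewrite opprB addrCA subrr addr0.
      apply: le_trans (ler_normB _ _) _; rewrite subKr.
      exact: lerD (DiM _) _.
    have : M * (e1 * `|d|) <= `|d| / 2.
      rewrite mulrA mulrC; apply: ler_wpM2l => //.
      have : e1 <= (2 * M)^-1 by rewrite ge_min lexx.
      by rewrite -(ler_pM2l M0) invfM mulrCA divff ?gt_eqF// mulr1.
    lra.
  rewrite [X in `|X|](_ : _ = S (h + q) - (p + Di h))//.
  rewrite opprD addrA -/d distrC; apply: le_trans DiTd _.
  apply: (@le_trans _ _ (M * (e1 * (2 * M * `|h|)))).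
    by rewrite ler_pM2l// ler_pM2l.
  rewrite [leLHS](_ : _ = e1 * (2 * M * M) * `|h|); last by ring.
  apply: ler_wpM2r => //; rewrite -ler_pdivlMr ?mulr_gt0//.
  by rewrite ge_min lexx orbT.
have dS := diff_unique Dic S_diff; split=> //.
by apply/diff_locallyP; rewrite dS.
Unshelve. all: by end_near. Qed.

Variables T S : V -> V.
Hypotheses (SK : cancel S T) (Sc : continuous S).
Hypothesis dT_inj : forall p v, 'd T p v = 0 -> v = 0.

Let J p := coordinate_mx c ('d T p).

Let J_unit p : J p \in unitmx.
Proof. exact/coordinate_mx_unit/dT_inj. Qed.

(** The inverse of ['d T p], written so that it depends on [p] only through the entries of
    [invmx (J p)]. *)
Let Di p v := \sum_j (c v *m invmx (J p)) 0 j *: e j.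

Let diffS q : differentiable T (S q) ->
  differentiable S q /\ 'd S q = Di (S q) :> (V -> V).
Proof.
move=> dT; set p := S q.
have linDi : linear (Di p).
  move=> a u v; rewrite /Di scaler_sumr -big_split/=; apply: eq_bigr => j _.
  by rewrite linearP mulmxDl -scalemxAl !mxE scalerA -scalerDl.
pose DiM := GRing.isLinear.Build _ _ _ _ _ linDi.
pose DiL : {linear V -> V} := HB.pack (Di p) DiM.
have DiC : class_C 0 DiL.
  apply: class_C_sum => j; apply: class_CZ; last exact: class_C_cst.
  rewrite (_ : (fun v => _) = (fun v => \sum_i c v 0 i * invmx (J p) i j)).
    apply: class_C_sum => i; apply: class_CM; last exact: class_C_cst.
    by apply: (class_C_coordinate c (h := id)) => p0; exact: cvg_id.
  by apply/funext => v; rewrite mxE.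
apply: (diff_inverse (Di := DiL)) => //; first exact: Sc.
move=> v.
rewrite -[LHS]/(Di p ('d T p v)) /Di (coordinate_mxE c ('d T p)) mulmxK ?J_unit//.
exact: coordinateK.
Qed.

(* By Cramer's rule, J^-1 composed with S is as smooth as J and S are, and it
   is the derivative of S: the smoothness of S increases by one. *)
Lemma class_C_inverse k : class_C k T -> class_C k S.
Proof.
elim: k => [//|k IH] TC.
have SC := IH (class_CS TC); case: TC => dT TC.
split=> [q|v]; first by have [] := diffS (dT (S q)).
rewrite (_ : (fun q => _) = (fun q => Di (S q) v)).
  apply: class_C_sum => j; apply: class_CZ; last exact: class_C_cst.
  rewrite (_ : (fun q => _) =
    (fun q => \sum_i c v 0 i * invmx (J (S q)) i j)).
    apply: class_C_sum => i; apply: class_CM; first exact: class_C_cst.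
    apply: (class_C_invmx (A := J \o S)) => [p|a b]; first exact: J_unit.
    rewrite (_ : (fun p => _) = (fun p => c ('d T p (e a)) 0 b) \o S).
      apply: (class_C_comp c) => //.
      exact: class_C_coordinate (TC _).
    by apply/funext => p; rewrite /= mxE.
  by apply/funext => q; rewrite mxE.
by apply/funext => q; have [_ ->] := diffS (dT (S q)).
Qed.

End InverseFunction.

(** * Symmetry of second derivatives *)

Section Schwarz.
Variables (R : realType) (V : normedModType R).

Lemma mean_value (F : V -> R) (x v : V) (s : R) :
  (forall q, differentiable F q) -> 0 < s ->
  exists2 t, 0 < t < s & F (x + s *: v) - F x = s * 'd F (x + t *: v) v.
Proof.
move=> dF s0; pose a : R -> V := cst x + *:%R^~ v.
have da t : is_diff t a (0 + *:%R^~ v) by exact: is_diffD.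
have da' t : differentiable a t by have [] := da t.
have dFa t : differentiable (F \o a) t.
  by apply: differentiable_comp; [exact: da'|exact: dF].
have [||t] := @MVT R (F \o a) (fun t => 'd F (x + t *: v) v) 0 s s0.
- move=> t _; apply: DeriveDef; first exact: diff_derivable.
  rewrite deriveE// diff_comp//=.
  have [_ ->] := da t; by rewrite [(0 + _) 1]add0r scale1r.
- by apply: continuous_subspaceT => t; exact/differentiable_continuous.
rewrite in_itv/= => ts; rewrite /a !fctE/= scale0r addr0 subr0 mulrC => Fs.
by exists t.
Qed.

(** Two mean values: along [u] for [q |-> h (q + s *: v) - h q], then along [v] for
    [q |-> 'd h q u]. *)
Lemma second_difference (h : V -> R) p u v s : class_C 2 h -> 0 < s ->
  exists t r, [/\ 0 < t < s, 0 < r < s &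
    h (p + s *: u + s *: v) - h (p + s *: u) - (h (p + s *: v) - h p) =
    s * (s * 'd (fun q => 'd h q u) (p + t *: u + r *: v) v)].
Proof.
move=> [dh hC] s0; pose sh : V -> V := id + cst (s *: v).
pose F := (h \o sh) - h.
have dsh q : is_diff q sh (id + 0) by exact: is_diffD.
have dsh' q : differentiable sh q by have [] := dsh q.
have dhsh q : differentiable (h \o sh) q.
  apply: differentiable_comp; last exact: dh.
  exact: dsh'.
have dF q : differentiable F q by exact: differentiableB.
have dFE q w : 'd F q w = 'd h (sh q) w - 'd h q w.
  rewrite -[LHS]/(('d F q : V -> R) w) (diffB (dhsh q) (dh q)).
  rewrite -[LHS]/(('d (h \o sh) q : V -> R) w - 'd h q w).
  rewrite (diff_comp (dsh' q) (dh (sh q))).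
  rewrite -[LHS]/('d h (sh q) (('d sh q : V -> V) w) - 'd h q w).
  by have [_ ->] := dsh q; rewrite [(id + 0) w]addr0.
have [t ts Ft] := mean_value p u dF s0.
have dhu q : differentiable (fun q => 'd h q u) q by have [+ _] := hC u; exact.
have [r rs hr] := mean_value (p + t *: u) v dhu s0.
exists t, r; split=> //.
transitivity (F (p + s *: u) - F p); first by [].
rewrite Ft; congr (s * _); rewrite -hr.
exact: dFE.
Qed.

(** The second difference is symmetric in [u] and [v], so [A] and [B] take a common value at two
    points arbitrarily close to [p]; continuity of both concludes. *)
Lemma diff2_sym (h : V -> R) p u v : class_C 2 h ->
  'd (fun q => 'd h q u) p v = 'd (fun q => 'd h q v) p u.
Proof.
move=> hC; set A := fun q => 'd (fun q => 'd h q u) q v.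
set B := fun q => 'd (fun q => 'd h q v) q u.
have [_ hC1] := hC.
have Ac : continuous A by have [_ /(_ v)] := hC1 u.
have Bc : continuous B by have [_ /(_ u)] := hC1 v.
suff : `|A p - B p| <= 0 by rewrite normr_le0 subr_eq0 => /eqP.
apply/ler_addgt0Pl => eps eps0; rewrite addr0.
have e20 : 0 < eps / 2 by rewrite divr_gt0.
have /cvgrPdist_lt/(_ _ e20) An := Ac p.
have /cvgrPdist_lt/(_ _ e20) Bn := Bc p.
have /nbhs_ballP[d /= d0 dAB] : \forall q \near p,
    `|A p - A q| < eps / 2 /\ `|B p - B q| < eps / 2.
  by apply: filterI; [exact: An|exact: Bn].
(* The summand 1 makes [M] positive and [s * (]|u| + [|v|)] strictly less than [d], which keeps all
   mean-value points in the ball. *)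
pose M := `|u| + `|v| + 1.
have M0 : 0 < M by rewrite ltr_wpDl// addr_ge0.
pose s := d / M; have s0 : 0 < s by rewrite divr_gt0.
have AB t r : 0 < t < s -> 0 < r < s ->
    `|A p - A (p + t *: u + r *: v)| < eps / 2 /\
    `|B p - B (p + t *: u + r *: v)| < eps / 2.
  move=> /andP[t0 ts] /andP[r0 rs]; apply: dAB.
  rewrite -ball_normE /= -addrA opprD addrA subrr add0r normrN.
  apply: le_lt_trans (ler_normD _ _) _; rewrite !normrZ !gtr0_norm//.
  apply: (@le_lt_trans _ _ (s * (`|u| + `|v|))).
    by rewrite mulrDr lerD// ler_wpM2r// ltW.
  by rewrite /s -mulrA gtr_pMr// ltr_pdivrMl// mulr1 ltrDl.
have [t [r [ts rs Atr]]] := second_difference p u v hC s0; rewrite -/(A _) in Atr.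
have [r' [t' [rs' ts' Btr]]] := second_difference p v u hC s0; rewrite -/(B _) in Btr.
have [Anear _] := AB _ _ ts rs.
have [_ Bnear] := AB _ _ ts' rs'.
have ABeq : A (p + t *: u + r *: v) = B (p + t' *: u + r' *: v).
  have sn0 : s != 0 by rewrite gt_eqF.
  apply: (mulfI sn0); apply: (mulfI sn0).
  rewrite -Atr [p + t' *: u + _]addrAC -Btr [p + s *: v + _]addrAC.
  by rewrite !opprB; ring.
rewrite (_ : A p - B p = A p - A (p + t *: u + r *: v) -
  (B p - B (p + t' *: u + r' *: v))); last by rewrite ABeq; ring.
by apply: le_trans (ler_normB _ _) _; rewrite (splitr eps) ltW// ltrD.
Qed.

End Schwarz.

(** * Eigenvalue counts and Sylvester's law of inertia *)

Lemma char_poly_similar (F : fieldType) N (P D : 'M[F]_N) :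
  P \in unitmx -> char_poly (invmx P *m D *m P) = char_poly D.
Proof.
move=> Pu; rewrite /char_poly; pose Q := map_mx polyC P.
pose Q' := map_mx polyC (invmx P).
have Q'Q : Q' *m Q = 1%:M by rewrite -map_mxM mulVmx// map_mx1.
have -> : char_poly_mx (invmx P *m D *m P) = Q' *m char_poly_mx D *m Q.
  rewrite /char_poly_mx !map_mxM mulmxBr mulmxBl; congr (_ - _).
  by rewrite -scalemx1 -scalemxAr mulmx1 -scalemxAl Q'Q.
rewrite !det_mulmx mulrAC -det_mulmx Q'Q det1 mul1r.
by [].
Qed.

Lemma char_poly_diag (F : fieldType) N (d : 'rV[F]_N) :
  char_poly (diag_mx d) = \prod_i ('X - (d 0 i)%:P).
Proof.
rewrite char_poly_trig ?diag_mx_is_trig//.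
by apply: eq_bigr => i _; rewrite mxE eqxx.
Qed.

Lemma mup_prod_XsubC (F : fieldType) N (d : 'I_N -> F) x :
  mup x (\prod_i ('X - (d i)%:P)) = (\sum_i (d i == x))%N.
Proof.
(* Nonvanishing is carried through the induction because multiplicities add for nonzero factors. *)
have [] : mup x (\prod_i ('X - (d i)%:P)) = (\sum_i (d i == x))%N /\
    \prod_i ('X - (d i)%:P) != 0.
  elim/big_ind2 : _ => [|k p l q [kp p0] [lq q0]|i _].
  - by rewrite mupNroot ?root1// oner_neq0.
  - by rewrite mupM// kp lq mulf_neq0.
  - by rewrite -(expr1 ('X - _)) mup_XsubCX expr1 polyXsubC_eq0; case: eqP.
by [].
Qed.

Lemma eigenvalue_count_prod (R : realType) N (P : set R) (A : 'M[R]_N) (d : 'I_N -> R) :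
  char_poly A = \prod_i ('X - (d i)%:P) ->
  eigenvalue_count P A = #|[pred i | d i \in P]|.
Proof.
move=> Ad; rewrite /eigenvalue_count.
under eq_fsbigr do rewrite Ad mup_prod_XsubC.
(* The sum over [P] is supported on the finitely many values of [d]. After exchanging the sums, each
   index [i] contributes once, at [x = d i], exactly when that value lies in [P]. *)
pose r := undup [seq d i | i <- enum 'I_N].
have dr i : d i \in r by rewrite mem_undup map_f// mem_enum.
rewrite -[P in LHS]set_mem_set -(@bigfs _ _ _ _ r) ?undup_uniq//; last first.
  move=> x _ xr; rewrite big1// => i _; apply/eqP; rewrite eqb0.
  by apply: contraNneq xr => <-; exact: dr.
rewrite exchange_big -sum1_card [RHS]big_mkcond; apply: eq_bigr => i _.
rewrite big_mkcond (bigD1_seq (d i)) ?undup_uniq//= eqxx big1 ?addn0.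
  by [].
by move=> x; rewrite eq_sym => /negbTE ->; case: ifP.
Qed.

Section Inertia.
Local Open Scope sesquilinear_scope.

Lemma diag_form (C : numClosedFieldType) N (d u : 'rV[C]_N) :
  (u *m diag_mx d *m u^t*) 0 0 = \sum_i d 0 i * `|u 0 i| ^+ 2.
Proof.
rewrite mxE; apply: eq_bigr => i _; rewrite mul_mx_diag !mxE.
by rewrite normCK mulrAC mulrC mulrA.
Qed.

(* If there were more positive e's than positive d's, some u <> 0 supported on
   the positive e's would have u *m S vanishing on the positive d's, and the
   form would be both positive and nonpositive at u. *)
Lemma card_pos_diag_le (C : numClosedFieldType) N (d e : 'rV[C]_N) S :
  d \is a realmx -> diag_mx e = S *m diag_mx d *m S^t* ->
  (#|[pred i | (0 < e 0 i)%R]| <= #|[pred i | (0 < d 0 i)%R]|)%N.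
Proof.
move=> /mxOverP dR eS; set I := [pred i | 0 < e 0 i]; set J := [pred i | 0 < d 0 i].
rewrite leqNgt; apply/negP => JI.
pose K := mxsub (enum_val (A := I)) (enum_val (A := J)) S.
(* [K] has more rows than columns, hence a nontrivial left kernel. *)
have [v v0 vK] : exists2 v : 'rV_#|I|, v != 0 & v *m K = 0.
  have : kermx K != 0.
    rewrite kermx_eq0 -row_leq_rank -ltnNge.
    by apply: leq_ltn_trans (rank_leq_col K) JI.
  case/rowV0Pn => v /sub_kermxP vK v0; by exists v.
pose u := v *m rowsub (enum_val (A := I)) 1%:M.
have uE a : u 0 (enum_val a) = v 0 a.
  rewrite mxE (bigD1 a)//= !mxE eqxx mulr1 big1 ?addr0// => b ba.
  by rewrite !mxE (inj_eq enum_val_inj) (negbTE ba) mulr0.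
have u0 i : i \notin I -> u 0 i = 0.
  move=> iI; rewrite mxE big1// => b _; rewrite !mxE.
  have [bi|_] := eqVneq (enum_val b) i; last by rewrite mulr0.
  by rewrite -bi enum_valP in iI.
have uS j : j \in J -> (u *m S) 0 j = 0.
  move=> jJ; rewrite -(enum_rankK_in jJ jJ); set b := enum_rank_in _ _.
  transitivity ((v *m K) 0 b); last by rewrite vK mxE.
  rewrite /u -mulmxA mul_rowsub_mx mul1mx !mxE; apply: eq_bigr => a _.
  by rewrite !mxE.
have := diag_form e u; rewrite eS !mulmxA -mulmxA -map_mxM -trmx_mul diag_form.
move=> /eqP; rewrite lt_eqF//; apply: (@le_lt_trans _ _ 0).
  apply: sumr_le0 => j _; have [jJ|] := boolP (j \in J).
    by rewrite uS// normr0 expr0n mulr0.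
  rewrite inE -real_leNgt ?real0 ?dR//.
  by move=> dj; rewrite mulr_le0_ge0// exprn_ge0.
have [a va] : exists a, v 0 a != 0.
  by apply/rV0Pn.
rewrite (bigD1 (enum_val a))//= ltr_wpDr//.
  apply: sumr_ge0 => i _; have [|iI] := boolP (i \in I).
    by rewrite inE => ei; rewrite mulr_ge0 ?exprn_ge0// ltW.
  by rewrite u0// normr0 expr0n mulr0.
rewrite mulr_gt0//; last by rewrite uE exprn_gt0// normr_gt0.
by have := enum_valP a; rewrite inE.
Qed.

Local Notation "A %:C" := (map_mx (@real_complex _) A) : sesquilinear_scope.

Variables (R : realType) (N : nat).
Implicit Types A B S : 'M[R]_N.

Lemma trC_real m n (A : 'M[R]_(m, n)) : (A %:C)^t* = A^T %:C.
Proof.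
apply/matrixP => i j; rewrite !mxE; exact: conjc_real.
Qed.

(** Over [R[i]] the matrix is Hermitian, so its eigenvalues are real and the diagonal descends to
    [R]. [P] may stay complex: only [d] enters the counts. *)
Lemma symmetric_spectral A : A^T = A ->
  exists (d : 'rV[R]_N) (P : 'M[R[i]]_N),
    P \is unitarymx /\ A %:C = invmx P *m diag_mx (d %:C) *m P.
Proof.
move=> AT; pose D := spectral_diag (A %:C).
have Aherm : A %:C \is hermsymmx.
  by apply/is_hermitianmxP; rewrite expr0 scale1r trC_real AT.
have /mxOverP Dreal := hermitian_spectral_diag_real Aherm.
exists (\row_i complex.Re (D 0 i)), (spectralmx (A %:C)).
split; first exact: spectral_unitarymx.
have /orthomx_spectralP {1}-> := hermitian_normalmx Aherm.
suff -> : (\row_i complex.Re (D 0 i)) %:C = D by [].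
by apply/rowP => i; rewrite !mxE RRe_real.
Qed.

Lemma char_poly_spectral A (d : 'rV[R]_N) (P : 'M[R[i]]_N) :
  P \is unitarymx -> A %:C = invmx P *m diag_mx (d %:C) *m P ->
  char_poly A = \prod_i ('X - (d 0 i)%:P).
Proof.
move=> Pu AP; apply: (map_poly_inj (@real_complex R)).
rewrite map_char_poly AP char_poly_similar ?unitarymx_unit//.
rewrite -map_diag_mx -map_char_poly char_poly_diag.
by [].
Qed.

(** For unitary [P] and [Q], inverse and conjugate transpose agree, so the diagonalisations are
    congruences as well as similarities. They compose with [S] into the congruence
    [Q *m S *m invmx P] between the diagonals. *)
Lemma card_pos_congr_le (a b : 'rV[R]_N) (P Q : 'M[R[i]]_N) A B S :
  P \is unitarymx -> Q \is unitarymx ->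
  A %:C = invmx P *m diag_mx (a %:C) *m P ->
  B %:C = invmx Q *m diag_mx (b %:C) *m Q ->
  B = S *m A *m S^T ->
  (#|[pred i | (0 < b 0 i)%R]| <= #|[pred i | (0 < a 0 i)%R]|)%N.
Proof.
move=> Pu Qu AP BQ BS.
have := @card_pos_diag_le _ _ (a %:C) (b %:C) (Q *m S %:C *m invmx P).
have posE (c : 'rV[R]_N) :
    #|[pred i | 0 < (c %:C) 0 i]| = #|[pred i | (0 < c 0 i)%R]|.
  by apply: eq_card => i; rewrite !inE mxE ltcR.
rewrite !posE; apply.
  by apply/mxOverP => i j; rewrite mxE complex_real.
have -> : diag_mx (b %:C) = Q *m B %:C *m invmx Q.
  by rewrite BQ !mulmxA mulmxV ?unitarymx_unit// mul1mx mulmxK ?unitarymx_unit.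
rewrite BS !map_mxM AP !trmx_mul !map_mxM -trC_real.
by rewrite (invmx_unitary Pu) (invmx_unitary Qu) trmxCK !mulmxA.
Qed.

(** One inequality on positive counts suffices: [invmx S] reverses it, passing to [- A] and [- B]
    handles the negative counts, and the zero counts follow because the three add up to [N]. *)
Lemma same_inertia_congr A B S :
  A^T = A -> S \in unitmx -> B = S *m A *m S^T -> same_inertia B A.
Proof.
move=> AT Su BS.
have BT : B^T = B by rewrite BS !trmx_mul trmxK AT mulmxA.
have AS : A = invmx S *m B *m (invmx S)^T.
  by rewrite BS !mulmxA mulVmx// mul1mx -mulmxA -trmx_mul mulVmx// trmx1 mulmx1.
have [a [P [Pu AP]]] := symmetric_spectral AT.
have [b [Q [Qu BQ]]] := symmetric_spectral BT.
have Ac := char_poly_spectral Pu AP; have Bc := char_poly_spectral Qu BQ.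
have pos : #|[pred i | (0 < b 0 i)%R]| = #|[pred i | (0 < a 0 i)%R]|.
  apply/eqP; rewrite eqn_leq (card_pos_congr_le Pu Qu AP BQ BS).
  by rewrite (card_pos_congr_le Qu Pu BQ AP AS).
have oppE (U : 'M[R[i]]_N) (c : 'rV[R]_N) X :
    X %:C = invmx U *m diag_mx (c %:C) *m U ->
    (- X) %:C = invmx U *m diag_mx ((- c) %:C) *m U.
  by move=> XU; rewrite !map_mxN XU linearN mulmxN mulNmx.
have neg : #|[pred i | (b 0 i < 0)%R]| = #|[pred i | (a 0 i < 0)%R]|.
  have NE (c : 'rV[R]_N) :
      #|[pred i | (c 0 i < 0)%R]| = #|[pred i | (0 < (- c) 0 i)%R]|.
    by apply: eq_card => i; rewrite !inE mxE oppr_gt0.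
  rewrite !NE; apply/eqP; rewrite eqn_leq.
  rewrite (card_pos_congr_le Pu Qu (oppE _ _ _ AP) (oppE _ _ _ BQ) (S := S)).
    rewrite (card_pos_congr_le Qu Pu (oppE _ _ _ BQ) (oppE _ _ _ AP)
      (S := invmx S))//.
    by rewrite mulmxN mulNmx -AS.
  by rewrite mulmxN mulNmx -BS.
have zero : #|[pred i | b 0 i == 0]| = #|[pred i | a 0 i == 0]|.
  have tot (c : 'rV[R]_N) : (#|[pred i | (0 < c 0 i)%R]| +
      #|[pred i | (c 0 i < 0)%R]| + #|[pred i | (c 0 i == 0)%R]|)%N = N.
    have cardE (p : pred 'I_N) : #|p| = (\sum_i p i)%N.
      by rewrite -sum1_card big_mkcond.
    rewrite !cardE -!big_split/= -[RHS]card_ord -sum1_card.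
    by apply: eq_bigr => i _; case: ltgtP.
  by have := tot b; rewrite -[in RHS](tot a) pos neg => /addnI.
split; rewrite (eigenvalue_count_prod _ Ac) (eigenvalue_count_prod _ Bc).
- rewrite (eq_card (B := [pred i | 0 < b 0 i])) ?pos; last first.
    by move=> i; rewrite !inE; apply/idP/idP; rewrite inE.
  by apply: eq_card => i; rewrite !inE; apply/idP/idP; rewrite inE.
- rewrite (eq_card (B := [pred i | b 0 i < 0])) ?neg; last first.
    by move=> i; rewrite !inE; apply/idP/idP; rewrite inE.
  by apply: eq_card => i; rewrite !inE; apply/idP/idP; rewrite inE.
- rewrite (eq_card (B := [pred i | b 0 i == 0])) ?zero; last first.
    by move=> i; rewrite !inE; apply/idP/idP; rewrite inE => /eqP.
  by apply: eq_card => i; rewrite !inE; apply/idP/idP; rewrite inE => /eqP.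
Qed.

End Inertia.

(** * Critical points and second derivatives under a diffeomorphism *)

Section Diffeomorphism.
Variables (R : realType) (V : normedModType R).

Lemma diff_sum (W : normedModType R) N (h : 'I_N -> V -> W) p v :
  (forall i, differentiable (h i) p) ->
  'd (fun q => \sum_i h i q) p v = \sum_i 'd (h i) p v.
Proof.
move=> dh; rewrite (_ : (fun q => _) = \sum_i h i); last first.
  by apply/funext => q; rewrite fct_sumE.
have dsum : differentiable (\sum_i h i) p by exact: differentiable_sum.
rewrite -deriveE// derive_sum; last by move=> i; exact: diff_derivable.
by apply: eq_bigr => i _; rewrite deriveE.
Qed.

Lemma diff_compE (U W : normedModType R) (h : V -> U) (f : U -> W) p v :
  differentiable h p -> differentiable f (h p) ->
  'd (f \o h) p v = 'd f (h p) ('d h p v).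
Proof.
move=> dh df; exact: (congr1 (fun F : V -> W => F v) (diff_comp dh df)).
Qed.

Lemma diff_cancel (Phi Psi : V -> V) p :
  (forall q, differentiable Phi q) -> (forall q, differentiable Psi q) ->
  cancel Phi Psi -> cancel ('d Phi p) ('d Psi (Phi p)).
Proof.
move=> dPhi dPsi K v.
rewrite -(diff_compE _ (dPhi p) (dPsi (Phi p))).
rewrite (_ : Psi \o Phi = id); last by apply/funext => q; rewrite /= K.
by rewrite diff_val.
Qed.

(** From [f \o Phi] to [f], the point is that ['d Phi p] is onto, with right inverse
    ['d Psi (Phi p)]. *)
Lemma critical_point_diffeo (Phi Psi : V -> V) (f : V -> R) p :
  (forall q, differentiable Phi q) -> (forall q, differentiable Psi q) ->
  (forall q, differentiable f q) -> cancel Phi Psi -> cancel Psi Phi ->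
  critical_point (f \o Phi) p <-> critical_point f (Phi p).
Proof.
move=> dPhi dPsi df K K'.
have dfPhi v : 'd (f \o Phi) p v = 'd f (Phi p) ('d Phi p v).
  exact: diff_compE.
split=> [fc v|fc v]; last by rewrite dfPhi fc.
have := diff_cancel (Phi p) dPsi dPhi K' v; rewrite K => <-.
by rewrite -dfPhi fc.
Qed.

Lemma near_homeo (Phi Psi : V -> V) (P : V -> Prop) p :
  continuous Phi -> continuous Psi -> cancel Phi Psi -> cancel Psi Phi ->
  (\forall q \near p, P (Phi q)) <-> (\forall q \near Phi p, P q).
Proof.
move=> cPhi cPsi K K'; split=> [Pp|]; last exact: (cPhi p).
have cPsip : Psi q @[q --> Phi p] --> p by rewrite -[X in _ --> X]K; exact: cPsi.
have H : \forall q \near Phi p, P (Phi (Psi q)) by exact: (cPsip _ Pp).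
by apply: (@filterS _ (nbhs (Phi p)) _ _ _ _ H) => q; rewrite K'.
Qed.

Variables (N : nat) (c : coordinates V N).
Local Notation e := (basis_vector c).

Lemma coordinate_mx_diff_unit (Phi Psi : V -> V) k p :
  class_C k.+1 Phi -> class_C k.+1 Psi -> cancel Phi Psi ->
  coordinate_mx c ('d Phi p) \in unitmx.
Proof.
move=> [dPhi _] [dPsi _] K; apply: coordinate_mx_unit => v Phiv0.
by have := diff_cancel p dPhi dPsi K v; rewrite Phiv0 => <-; exact: linear0.
Qed.

Lemma diff2_comp (Phi : V -> V) (f : V -> R) p u v :
  class_C 2 Phi -> class_C 2 f -> critical_point f (Phi p) ->
  'd (fun q => 'd (f \o Phi) q u) p v =
  \sum_k c ('d Phi p u) 0 k *
    'd (fun q => 'd f q (e k)) (Phi p) ('d Phi p v).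
Proof.
move=> PhiC2 fC2 fcrit; have [dPhi _] := PhiC2; have [df _] := fC2.
have -> : (fun q => 'd (f \o Phi) q u) =
    (fun q => \sum_k c ('d Phi q u) 0 k *: ((fun q => 'd f q (e k)) \o Phi) q).
  apply/funext => q.
  rewrite (diff_compE _ (dPhi q) (df (Phi q))).
  by rewrite (linear_coordinates c).
have dfe k q : differentiable (fun q => 'd f q (e k)) q
  by exact: class_C_differentiable (class_C_diff _ fC2).
have dfePhi k : differentiable ((fun q => 'd f q (e k)) \o Phi) p.
  exact: differentiable_comp.
have dc k : differentiable (fun q => c ('d Phi q u) 0 k) p.
  exact: class_C_differentiable (class_C_coordinate c k (class_C_diff u PhiC2)).
rewrite diff_sum; last by move=> k; exact: differentiable_scale.
apply: eq_bigr => k _.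
(* The only term with a second derivative of [Phi] has the factor ['d f (Phi p) (e k)], which
   vanishes at a critical point. *)
rewrite (diff_scale _ (dc k) (dfePhi k)) /= fcrit scaler0 addr0.
by rewrite (diff_compE _ (dPhi p) (dfe k (Phi p))).
Qed.

End Diffeomorphism.

(** * Hessians on the product space *)

Section Hessian.
Variables (R : realType) (n m : nat).
Local Notation V := ('rV[R]_n * 'rV[R]_m)%type.

Let row_pair (p : V) : 'rV[R]_(n + m) := row_mx p.1 p.2.

Let row_pair_linear : linear row_pair.
Proof. by move=> a p q; rewrite /row_pair -add_row_mx scale_row_mx. Qed.

HB.instance Definition _ := GRing.isLinear.Build _ _ _ _ _ row_pair_linear.

Let row_pair_continuous : continuous row_pair.
Proof.
rewrite (_ : row_pair = fun p => \sum_i row_pair p 0 i *: delta_mx 0 i); last first.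
  by apply/funext => p; exact: row_sum_delta.
apply: (@class_C_sum _ _ _ 0) => i; apply: class_CZ; last exact: class_C_cst.
have [j|j] := split_ordP i => ->.
  rewrite (_ : (fun p => _) = (fun u : 'rV[R]_n => u 0 j) \o fst); last first.
    by apply/funext => p; rewrite /row_pair row_mxEl.
  by move=> p; apply: continuous_comp; [exact: cvg_fst|exact: coord_continuous].
rewrite (_ : (fun p => _) = (fun u : 'rV[R]_m => u 0 j) \o snd); last first.
  by apply/funext => p; rewrite /row_pair row_mxEr.
by move=> p; apply: continuous_comp; [exact: cvg_snd|exact: coord_continuous].
Qed.

Let row_pair_basis i : row_pair (prod_basis R i) = delta_mx 0 i.
Proof. by rewrite /row_pair hsubmxK. Qed.

Let row_pairK (p : V) : \sum_i row_pair p 0 i *: prod_basis R i = p.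
Proof.
have -> : \sum_i row_pair p 0 i *: prod_basis R i =
    (lsubmx (row_pair p), rsubmx (row_pair p)).
  rewrite [row_pair p in RHS]row_sum_delta !linear_sum.
  rewrite [LHS]surjective_pairing -[LHS]/(fst _, snd _).
  rewrite (linear_sum fst) (linear_sum snd).
  by congr (_, _); apply: eq_bigr => i _; rewrite !linearZ.
by rewrite row_mxKl row_mxKr -surjective_pairing.
Qed.

(** The basis is the one that indexes [hessian], so the matrix of ['d Phi p] in these coordinates is
    itself the congruence factor. *)
Definition prod_coordinates : coordinates V (n + m) :=
  Coordinates row_pair_continuous row_pair_basis row_pairK.

Lemma hessianE (h : V -> R) p i j : class_C 2 h ->
  hessian h p i j = 'd (fun q => 'd h q (prod_basis R j)) p (prod_basis R i).
Proof.
move=> hC2; have [dh _] := hC2; rewrite mxE.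
rewrite (_ : (fun q => _) = (fun q => 'd h q (prod_basis R j))).
  by rewrite deriveE//; exact: class_C_differentiable (class_C_diff _ hC2).
by apply/funext => q; rewrite deriveE.
Qed.

Lemma tr_hessian (h : V -> R) p : class_C 2 h -> (hessian h p)^T = hessian h p.
Proof.
move=> hC; apply/matrixP => i j.
rewrite mxE (hessianE p j i hC) (hessianE p i j hC); exact: diff2_sym.
Qed.

Lemma hessian_comp (Phi : V -> V) (f : V -> R) p :
  class_C 2 Phi -> class_C 2 f -> critical_point f (Phi p) ->
  hessian (f \o Phi) p = coordinate_mx prod_coordinates ('d Phi p) *m
    hessian f (Phi p) *m (coordinate_mx prod_coordinates ('d Phi p))^T.
Proof.
move=> PhiC fC fcrit; apply/matrixP => i j.
rewrite (hessianE p i j (class_C_comp prod_coordinates PhiC fC)).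
rewrite (diff2_comp prod_coordinates _ _ PhiC fC fcrit) [RHS]mxE; apply: eq_bigr => k _.
rewrite [X in _ = X * _]mxE [X in _ = _ * X]mxE [X in _ = _ * X]mxE mulrC.
congr (_ * _).
rewrite (linear_coordinates prod_coordinates); apply: eq_bigr => l _.
by rewrite [X in _ = X * _]mxE (hessianE _ l k fC).
Qed.

Lemma same_inertia_hessian_comp (Phi Psi : V -> V) (f : V -> R) p :
  class_C 2 Phi -> class_C 2 Psi -> cancel Phi Psi ->
  class_C 2 f -> critical_point f (Phi p) ->
  same_inertia (hessian (f \o Phi) p) (hessian f (Phi p)).
Proof.
move=> PhiC PsiC K fC fcrit.
apply: same_inertia_congr (hessian_comp PhiC fC fcrit); first exact: tr_hessian.
exact: coordinate_mx_diff_unit PhiC PsiC K.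
Qed.

End Hessian.

(** Lets the Banach fixed-point theorem apply to row vectors. *)
HB.instance Definition _ (R : realType) (m n : nat) := Complete.on 'M[R]_(m, n).

(** * The Euclidean norm against the sup norm *)

Section L2norm.
Variables (R : realType) (m : nat).
Implicit Types u v : 'rV[R]_m.

Lemma l2norm_ge0 u : 0 <= l2norm u.
Proof. exact: sqrtr_ge0. Qed.

Lemma sqr_l2norm u : l2norm u ^+ 2 = \sum_j u 0 j ^+ 2.
Proof. by rewrite sqr_sqrtr// sumr_ge0// => j _; exact: sqr_ge0. Qed.

Lemma norm_le_l2norm u : `|u| <= l2norm u.
Proof.
rewrite -[leLHS]/(mx_norm u) mx_normrE; apply: bigmax_le => [|[i j] _]; first exact: l2norm_ge0.
rewrite /= ord1 -ler_sqr ?nnegrE ?l2norm_ge0// sqr_l2norm real_normK ?num_real//.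
by rewrite (bigD1 j)//= lerDl sumr_ge0// => l _; exact: sqr_ge0.
Qed.

Lemma l2norm_le_norm u : l2norm u <= Num.sqrt m%:R * `|u|.
Proof.
rewrite -ler_sqr ?nnegrE ?l2norm_ge0 ?mulr_ge0 ?sqrtr_ge0//.
rewrite sqr_l2norm exprMn sqr_sqrtr ?ler0n// mulr_natl.
have -> : `|u| ^+ 2 *+ m = \sum_(j < m) `|u| ^+ 2 by rewrite sumr_const card_ord.
apply: ler_sum => j _.
rewrite -real_normK ?num_real// ler_sqr ?nnegrE//.
rewrite -[leRHS]/(mx_norm u) mx_normrE.
exact: (le_bigmax _ (fun i => `|u i.1 i.2|) (0, j)).
Qed.

Lemma l2norm_scale a u : l2norm (a *: u) = `|a| * l2norm u.
Proof.
apply/eqP; rewrite -(eqrXn2 (n := 2))// ?mulr_ge0 ?l2norm_ge0//.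
rewrite exprMn !sqr_l2norm real_normK ?num_real// mulr_sumr.
by apply/eqP; apply: eq_bigr => j _; rewrite mxE exprMn.
Qed.

(* Summed over the coordinates, (a - c)^2 >= (1 - q) a^2 - (1/q - 1) c^2
   replaces the triangle inequality. *)
Lemma l2norm_sub_ge (q : R) u v : 0 < q < 1 ->
  l2norm v <= q * l2norm u -> (1 - q) * l2norm u <= l2norm (u - v).
Proof.
move=> /andP[q0 q1] vu; have q1' : 0 <= 1 - q by rewrite subr_ge0 ltW.
rewrite -ler_sqr ?nnegrE ?mulr_ge0 ?l2norm_ge0//.
have vu2 : l2norm v ^+ 2 <= q ^+ 2 * l2norm u ^+ 2.
  by rewrite -exprMn ler_sqr// nnegrE ?mulr_ge0 ?l2norm_ge0// ltW.
have : (1 - q) * l2norm u ^+ 2 - (q^-1 - 1) * l2norm v ^+ 2 <=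
    l2norm (u - v) ^+ 2.
  rewrite !sqr_l2norm !mulr_sumr -sumrB; apply: ler_sum => j _; rewrite !mxE.
  (* The gap between the two sides is [q a^2 - 2 a c + c^2 / q], a perfect square times [q]. *)
  rewrite -subr_ge0 [leRHS](_ : _ = q * (u 0 j - q^-1 * v 0 j) ^+ 2).
    by rewrite mulr_ge0 ?sqr_ge0// ltW.
  by field; rewrite gt_eqF.
apply: le_trans; rewrite exprMn.
have : (q^-1 - 1) * l2norm v ^+ 2 <= (q^-1 - 1) * (q ^+ 2 * l2norm u ^+ 2).
  by apply: ler_wpM2l vu2; rewrite subr_ge0 invf_ge1// ltW.
(* What remains is [(1 - q) - (1 - q) q = (1 - q)^2], the square of the constant sought. *)
rewrite [leRHS](_ : _ = (1 - q) * q * l2norm u ^+ 2); last by field; rewrite gt_eqF.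
rewrite expr2; nra.
Qed.

(* In the sup norm some iterate of an l2 contraction is a contraction. *)
Lemma l2_contraction_fixpoint (q : R) (F : 'rV[R]_m -> 'rV[R]_m) :
  0 <= q < 1 -> l2lipschitz q F -> exists z, F z = z.
Proof.
move=> /andP[q0 q1] Fq.
have Fk k y z : l2norm (iter k F y - iter k F z) <= q ^+ k * l2norm (y - z).
  elim: k => [|k IH]; first by rewrite expr0 mul1r.
  by rewrite !iterS exprS -mulrA (le_trans (Fq _ _))// ler_wpM2l.
(* The change of norm costs the fixed factor [Num.sqrt m%:R], while iterating gains [q ^+ k]. *)
have [k qk] : exists k, q ^+ k * Num.sqrt m%:R <= 2^-1.
  have : (fun k => q ^+ k * Num.sqrt m%:R) @ \oo --> (0 : R).
    rewrite -[X in _ --> X](mul0r (Num.sqrt m%:R)); apply: cvgM; last exact: cvg_cst.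
    by apply: cvg_expr; rewrite ger0_norm.
  move=> /cvgrPdist_lt/(_ 2^-1); rewrite invr_gt0 ltr0n => /(_ isT) [k _ /(_ k)].
  rewrite /= leqnn => /(_ isT) qk; exists k.
  by rewrite ltW// (le_lt_trans _ qk)// sub0r normrN ler_norm.
have Ffun : set_fun [set: 'rV[R]_m] [set: 'rV[R]_m] (iter k F) by [].
pose FkM := isFun.Build _ _ _ _ _ Ffun.
pose Ffk : {fun [set: 'rV[R]_m] >-> [set: 'rV[R]_m]} := HB.pack (iter k F) FkM.
have Fctr : is_contraction Ffk.
  exists (2^-1)%:nng; split; first by rewrite /= invf_lt1// ltr1n.
  move=> [y z] _ /=; apply: le_trans (norm_le_l2norm _) _.
  apply: le_trans (Fk _ _ _) _.
  apply: (@le_trans _ _ (q ^+ k * (Num.sqrt m%:R * `|y - z|))).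
    by rewrite ler_wpM2l ?exprn_ge0// l2norm_le_norm.
  by rewrite mulrA ler_wpM2r.
have [|z _ zk] := @banach_fixed_point R _ setT _ Fctr closedT.
  by exists 0.
(* [F z] is again fixed by the [k]-th iterate, so uniqueness gives [F z = z]. *)
exists z; apply: (contraction_fixpoint_unique Fctr) => //.
by rewrite /= -iterSr iterS; congr F.
Qed.

End L2norm.

(** * Inverting a map that preserves the first component *)

Section FibredInverse.
Variables (R : realType) (X Y : normedModType R) (N k : nat).
Variables (c : coordinates (X * Y)%type N) (h : X * Y -> Y) (M : R).
Hypotheses (hC : class_C k.+1 h).
Hypothesis h_surj : forall x w, exists z, h (x, z) = w.
Hypothesis h_expand : forall x z z',
  `|z - z'| <= M * `|h (x, z) - h (x, z')|.

Let T p := (p.1, h p).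

Let TC : class_C k.+1 T.
Proof. by apply: class_C_pair => //; exact: class_C_fst. Qed.

Let dT_inj p v : 'd T p v = 0 -> v = 0.
Proof.
have dh : differentiable h p := class_C_differentiable p hC.
have dfst : differentiable (fst : X * Y -> X) p.
  exact: class_C_differentiable (class_C_fst _ _ 1).
have fstc : continuous (fst : X * Y -> X).
  exact: class_C_continuous (class_C_fst X Y 0).
case: p v dh dfst => x z [u v] dh dfst.
rewrite (diff_pair dfst dh) => -[].
rewrite (diff_lin _ fstc) /= => u0; rewrite u0 => hv.
congr (_, _); apply/eqP; rewrite -normr_le0.
have hcvg : derivable h (x, z) (0, v) by exact: diff_derivable.
have Dcvg : (fun s : R => s^-1 *: (h (s *: (0, v) + (x, z)) - h (x, z))) @ 0^'
    --> (0 : Y).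
  by rewrite -hv -deriveE//; exact: hcvg.
have Ncvg : (fun s : R => M * `|s^-1 *: (h (s *: (0, v) + (x, z)) - h (x, z))|)
    @ 0^' --> 0.
  rewrite [X in _ --> X](_ : _ = M * `|0 : Y|); last by rewrite normr0 mulr0.
  by apply: cvgM; [exact: cvg_cst|exact: cvg_norm Dcvg].
apply: (cvgr_to_ge Ncvg).
near=> s; have s0 : s != 0 by near: s; exact: nbhs_dnbhs_neq.
have := h_expand x (s *: v + z) z; rewrite addrK normrZ.
rewrite -(ler_pM2l (_ : 0 < `|s|^-1)) ?invr_gt0 ?normr_gt0// mulKf ?normr_eq0//.
rewrite normrZ normfV mulrCA.
by rewrite -[s *: (0, v)]/(s *: 0, s *: v) scaler0 -[_ + (x, z)]/(0 + x, _) add0r.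
Unshelve. all: by end_near. Qed.

Lemma fibred_inverse :
  exists S, [/\ cancel T S, cancel S T & class_C k.+1 S].
Proof.
have /choice[s sh] : forall q, exists z, h (q.1, z) = q.2 by move=> q; exact: h_surj.
pose S q := (q.1, s q).
have SK : cancel S T by move=> q; rewrite /T /= sh -surjective_pairing.
have TK : cancel T S.
  move=> [x z]; congr (_, _); apply/eqP; rewrite -subr_eq0 -normr_le0.
  by apply: le_trans (h_expand x _ _) _; rewrite (sh (T (x, z))) subrr normr0 mulr0.
have sc : continuous s.
  move=> q0; apply/cvgrPdist_lt => _/posnumP[e].
  have sndc : continuous (snd : X * Y -> Y).
    exact: class_C_continuous (class_C_snd X Y 0).
  have hs : continuous (h \o (fun q : X * Y => (q.1, s q0))).
    move=> q; apply: continuous_comp; last exact: (class_C_continuous hC).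
    by apply: cvg_pair; [exact: cvg_fst|exact: cvg_cst].
  have hcvg : (fun q : X * Y => `|M| * `|h (q.1, s q0) - q.2|) @ q0 --> 0.
    rewrite [X in _ --> X](_ : _ = `|M| * `|h (q0.1, s q0) - q0.2|); last first.
      by rewrite sh subrr normr0 mulr0.
    apply: cvgM; first exact: cvg_cst.
    by apply: cvg_norm; apply: cvgB; [exact: (hs q0)|exact: (sndc q0)].
  have eg : \forall q \near q0, `|M| * `|h (q.1, s q0) - q.2| < e%:num.
    exact: (cvgr_lt _ hcvg).
  apply: (@filterS _ (nbhs q0) _ _ _ _ eg) => q; apply: le_lt_trans.
  apply: le_trans (h_expand q.1 _ _) _; rewrite sh distrC.
  by rewrite distrC ler_wpM2r// ler_norm.
have Sc : continuous S.
  have fstc : continuous (fst : X * Y -> X).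
    exact: class_C_continuous (class_C_fst X Y 0).
  by move=> q; apply: cvg_pair; [exact: (fstc q)|exact: sc].
exists S; split; [exact: TK|exact: SK|].
exact: (class_C_inverse c SK Sc dT_inj TC).
Qed.

End FibredInverse.

(** * The gradient step as a fibred diffeomorphism *)

Section GradientStep.
Variables (R : realType) (n m : nat) (g : 'rV[R]_n * 'rV[R]_m -> R).
Variables (L alpha : R).
Hypotheses (L0 : 0 < L) (alphaL : 0 < alpha * L < 1).
Hypothesis lip : forall x, l2lipschitz L (gradient (fun y => g (x, y))).

(** Partial derivatives in [y] are derivatives of [g] in the fixed directions [(0, delta_mx 0 j)],
    so exactly one order is spent, jointly in both variables. *)
Lemma class_C_gd_step k : class_C k.+1 g ->
  class_C k (fun p : 'rV[R]_n * 'rV[R]_m => gd_step g alpha p.1 p.2).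
Proof.
move=> gC; apply: class_CD; first exact: class_C_snd.
apply/class_CN/class_CZl.
rewrite (_ : (fun p => _) =
  (fun p => \sum_j 'd g p (0, delta_mx 0 j) *: delta_mx 0 j)).
  apply: class_C_sum => j; apply: class_CZ; last exact: class_C_cst.
  exact: class_C_diff gC.
apply/funext => -[x y]; rewrite [LHS]row_sum_delta; apply: eq_bigr => j _.
congr (_ *: _); rewrite mxE -deriveE; last exact: class_C_differentiable gC.
have gE (s : R) : s *: (0, delta_mx 0 j) + (x, y) = (x, s *: delta_mx 0 j + y).
  by congr (_, _); rewrite /= scaler0 add0r.
by rewrite /derive /=; under [in RHS]eq_fun do rewrite gE.
Qed.

Let alpha0 : 0 < alpha.
Proof. by have /andP[+ _] := alphaL; rewrite pmulr_lgt0. Qed.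

Let lip_scaled x y z :
  l2norm (alpha *: gradient (fun y => g (x, y)) y -
          alpha *: gradient (fun y => g (x, y)) z) <= alpha * L * l2norm (y - z).
Proof.
by rewrite -scalerBr l2norm_scale gtr0_norm// -mulrA ler_pM2l//; exact: lip.
Qed.

Lemma gd_step_surj x w : exists z, gd_step g alpha x z = w.
Proof.
have [] := @l2_contraction_fixpoint _ _ (alpha * L)
  (fun z => w + alpha *: gradient (fun y => g (x, y)) z).
- by have /andP[/ltW -> ->] := alphaL.
- by move=> y z; rewrite opprD addrACA subrr add0r.
- by move=> z zw; exists z; rewrite /gd_step -{1}zw addrK.
Qed.

(** The factor [1 - alpha * L] comes from perturbing the identity by a Euclidean contraction, and
    [Num.sqrt m%:R] from returning to the sup norm on the right. *)
Lemma gd_step_expand x y z : `|y - z| <=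
  Num.sqrt m%:R / (1 - alpha * L) * `|gd_step g alpha x y - gd_step g alpha x z|.
Proof.
have q1 : 0 < 1 - alpha * L by rewrite subr_gt0; have /andP[] := alphaL.
apply: le_trans (norm_le_l2norm _) _; rewrite mulrAC ler_pdivlMr// mulrC.
apply: le_trans (l2norm_le_norm _).
rewrite (_ : gd_step g alpha x y - _ = y - z -
  (alpha *: gradient (fun y => g (x, y)) y -
  alpha *: gradient (fun y => g (x, y)) z)).
  exact: l2norm_sub_ge alphaL (lip_scaled x y z).
by rewrite /gd_step !opprD addrACA.
Qed.

Lemma diffeomorphism_gd_step : class_C 3 g ->
  diffeomorphism (fun p : 'rV[R]_n * 'rV[R]_m => (p.1, gd_step g alpha p.1 p.2)).
Proof.
move=> gC; have hC := class_C_gd_step gC.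
have [S [K K' SC]] := fibred_inverse (prod_coordinates R n m) hC gd_step_surj
  gd_step_expand.
exists S; split; [exact: K|exact: K'| |exact: SC].
by apply: class_C_pair; [exact: class_C_fst|exact: hC].
Qed.

End GradientStep.

Lemma diffeomorphism_id (R : realType) (V : normedModType R) :
  diffeomorphism (id : V -> V).
Proof.
have idC : class_C 2 (id : V -> V).
  by apply: (@class_C_linear _ _ _ 2 idfun) => p; exact: cvg_id.
by exists id; split.
Qed.

Lemma diffeomorphism_comp (R : realType) (V : normedModType R) N
    (c : coordinates V N) (Phi Phi' : V -> V) :
  diffeomorphism Phi -> diffeomorphism Phi' -> diffeomorphism (Phi \o Phi').
Proof.
move=> [Psi [K KV C CV]] [Psi' [K' KV' C' CV']]; exists (Psi' \o Psi).
by split; [exact: can_comp|exact: can_comp|exact: (class_C_comp c)..].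
Qed.

Theorem proposition5p2 (R : realType) (n m : nat)
  (hn : (1 <= n)%N) (hm : (1 <= m)%N)
  (f g : 'rV[R]_n * 'rV[R]_m -> R)
  (hf : class_C 2 f) (hg : class_C 3 g)
  (Lg : R) (hLg : 0 < Lg)
  (hcoer : forall x : 'rV[R]_n, coercive (fun y => g (x, y)))
  (hlip : forall x : 'rV[R]_n,
     l2lipschitz Lg (gradient (fun y => g (x, y))))
  (alpha : R) (halpha : 0 < alpha * Lg < 1) (k : nat) :
  exists Phi : 'rV[R]_n * 'rV[R]_m -> 'rV[R]_n * 'rV[R]_m,
    [/\ diffeomorphism Phi,
        (forall p, critical_point (phi f g alpha k) p <->
                   critical_point f (Phi p))
      & forall p, critical_point (phi f g alpha k) p ->
          [/\ phi f g alpha k p = f (Phi p),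
              (local_minimum (phi f g alpha k) p <->
               local_minimum f (Phi p)),
              (local_maximum (phi f g alpha k) p <->
               local_maximum f (Phi p))
            & same_inertia (hessian (phi f g alpha k) p)
                           (hessian f (Phi p))]].
Proof.
pose T p : 'rV[R]_n * 'rV[R]_m := (p.1, gd_step g alpha p.1 p.2).
(* [T] keeps the first component, so iterating it runs the descent with [x] frozen. *)
have phiE : phi f g alpha k = f \o iter k T.
  apply/funext => -[x z]; rewrite /phi /=; congr f.
  by elim: k => [//|k IH]; rewrite !iterS -IH.
have diffeo : diffeomorphism (iter k T).
  elim: k {phiE} => [|k IH]; first exact: diffeomorphism_id.
  apply: (diffeomorphism_comp (prod_coordinates R n m) _ IH).
  exact: (diffeomorphism_gd_step hLg halpha hlip hg).
exists (iter k T); rewrite phiE; set Phi := iter k T.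
have [Psi [K K' PhiC PsiC]] := diffeo.
have crit p : critical_point (f \o Phi) p <-> critical_point f (Phi p).
  apply: (critical_point_diffeo _ _ _ _ K K') => q.
  - exact: class_C_differentiable PhiC.
  - exact: class_C_differentiable PsiC.
  - exact: class_C_differentiable hf.
split; [exact: diffeo|exact: crit|move=> p /crit fp; split; first by []].
- exact: (near_homeo (fun q => f (Phi p) <= f q) p
    (class_C_continuous PhiC) (class_C_continuous PsiC) K K').
- exact: (near_homeo (fun q => f q <= f (Phi p)) p
    (class_C_continuous PhiC) (class_C_continuous PsiC) K K').
- exact: same_inertia_hessian_comp PhiC PsiC K hf fp.
Qed.
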